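(* Let $(X,d)$ be a rectangular $b$-metric space with parameter $s>1$, let $\alpha,\eta:X\times X\to[0,+\infty)$ be two functions, and suppose that $(X,d)$ is $(\alpha,\eta)$-complete. Let $T:X\to X$ be a mapping satisfying the following assertions: (i) $T$ is triangular $(\alpha,\eta)$-admissible; (ii) $T$ is an $(\alpha,\eta)$-$\theta$-$\phi$-contraction; (iii) there exists $x_0\in X$ such that $\alpha(x_0,Tx_0)\ge 1$ or $\eta(x_0,Tx_0)\le 1$; (iv) $(X,d)$ is an $(\alpha,\eta)$-regular rectangular $b$-metric space. Then $T$ has a fixed point. Moreover, $T$ has a unique fixed point whenever, for all $z,u\in\mathrm{Fix}(T)$, $\alpha(z,u)\ge1$ or $\eta(z,u)\le1$.
   Context: $\mathrm{Fix}(T)=\{z\in X: Tz=z\}$. A rectangular $b$-metric space with parameter $s\ge 1$ is a nonempty set $X$ with a map $d:X\times X\to[0,+\infty)$ such that for all $x,y\in X$ and all distinct points $u,v\in X$, each distinct from $x$ and $y$: (1) $d(x,y)=0$ if and only if $x=y$; (2) $d(x,y)=d(y,x)$; (3) $d(x,y)\le s[d(x,u)+d(u,v)+d(v,y)]$. A sequence $(x_n)$ in $X$ converges to $x$ (written $x_n\to x$) if $d(x_n,x)\to 0$, and is Cauchy if $d(x_n,x_m)\to 0$ as $n,m\to\infty$. $(X,d)$ is $(\alpha,\eta)$-complete if every Cauchy sequence $(x_n)$ in $X$ such that, for all $n\in\mathbb{N}$, $\alpha(x_n,x_{n+1})\ge1$ or $\eta(x_n,x_{n+1})\le 1$, converges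 in $X$. $(X,d)$ is $(\alpha,\eta)$-regular if whenever $x_n\to x$ in $X$ and, for all $n\in\mathbb{N}$, $\alpha(x_n,x_{n+1})\ge1$ or $\eta(x_n,x_{n+1})\le1$, then, for all $n\in\mathbb{N}$, $\alpha(x_n,x)\ge1$ or $\eta(x_n,x)\le1$. $T$ is triangular $(\alpha,\eta)$-admissible if for all $x,y,z\in X$: (T1) $\alpha(x,y)\ge1\Rightarrow\alpha(Tx,Ty)\ge1$; (T2) $\eta(x,y)\le1\Rightarrow\eta(Tx,Ty)\le1$; (T3) $\alpha(x,y)\ge1$ and $\alpha(y,z)\ge1$ imply $\alpha(x,z)\ge1$; (T4) $\eta(x,y)\le1$ and $\eta(y,z)\le1$ imply $\eta(x,z)\le1$. $\Theta$ is the set of functions $\theta:(0,\infty)\to(1,\infty)$ such that: $\theta$ is increasing; for each sequence $(t_n)$ in $(0,\infty)$, $\lim_{n\to\infty}\theta(t_n)=1$ if and only if $\lim_{n\to\infty}t_n=0$; $\theta$ is continuous on $(0,\infty)$. $\Phi$ is the set of functions $\phi:[1,\infty)\to[1,\infty)$ such that: $\phi$ is non-decreasing; for each $t>1$, $\lim_{n\to\infty}\phi^n(t)=1$ (where $\phi^n$ is the $n$-th iterate); $\phi$ is continuous on $[1,\infty)$. $T$ is an $(\alpha,\eta)$-$\theta$-$\phi$-contraction (on a rectangular $b$-metric space with parameter $s>1$) if there are $\theta\in\Theta$, $\phi\in\Phi$ and reals $\beta_1,\beta_2,\beta_3,\beta_4\ge0$ with $\beta_1+\beta_2+\beta_3+\beta_4\le1$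 and $\beta_3<\frac1s$ such that for all $x,y\in X$ with ($\alpha(x,y)\ge1$ or $\eta(x,y)\le1$) and $d(Tx,Ty)>0$, $$\theta\big(s^2 d(Tx,Ty)\big)\le\phi\Big[\theta\big(\beta_1d(x,y)+\beta_2d(Tx,x)+\beta_3d(Ty,y)+\beta_4d(y,Tx)\big)\Big].$$ Since $\theta$ is defined only on $(0,\infty)$, this requirement includes that the argument of $\theta$ on the right-hand side is positive. *)

(* Defs.v *)
From Stdlib Require Import Reals.
From Coquelicot Require Import Coquelicot.
Open Scope R_scope.

Definition Fix {X : Type} (T : X -> X) (z : X) : Prop := T z = z.

Record rect_bmetric {X : Type} (s : R) (d : X -> X -> R) : Prop := {
  rbm_inhabited : inhabited X;
  rbm_param : 1 <= s;
  rbm_nonneg : forall x y, 0 <= d x y;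
  rbm_sep : forall x y, d x y = 0 <-> x = y;
  rbm_sym : forall x y, d x y = d y x;
  rbm_rect : forall x y u v,
    u <> v -> u <> x -> u <> y -> v <> x -> v <> y ->
    d x y <= s * (d x u + d u v + d v y)
}.

Definition converges {X : Type} (d : X -> X -> R) (x_ : nat -> X) (x : X) : Prop :=
  is_lim_seq (fun n => d (x_ n) x) 0.

Definition cauchy_seq {X : Type} (d : X -> X -> R) (x_ : nat -> X) : Prop :=
  filterlim (fun p : nat * nat => d (x_ (fst p)) (x_ (snd p)))
    (filter_prod eventually eventually) (locally 0).

(* The disjunction is evaluated separately at each pair of points: along a
   sequence, different indices may satisfy different alternatives. *)
Definition alpha_eta_rel {X : Type} (alpha eta : X -> X -> R) (x y : X) : Prop :=
  1 <= alpha x y \/ eta x y <= 1.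

Definition alpha_eta_complete {X : Type} (alpha eta d : X -> X -> R) : Prop :=
  forall x_ : nat -> X,
    cauchy_seq d x_ ->
    (forall n, alpha_eta_rel alpha eta (x_ n) (x_ (S n))) ->
    exists x, converges d x_ x.

Definition alpha_eta_regular {X : Type} (alpha eta d : X -> X -> R) : Prop :=
  forall (x_ : nat -> X) (x : X),
    converges d x_ x ->
    (forall n, alpha_eta_rel alpha eta (x_ n) (x_ (S n))) ->
    forall n, alpha_eta_rel alpha eta (x_ n) x.

Record triangular_admissible {X : Type} (alpha eta : X -> X -> R) (T : X -> X) : Prop := {
  adm_alpha : forall x y, 1 <= alpha x y -> 1 <= alpha (T x) (T y);
  adm_eta : forall x y, eta x y <= 1 -> eta (T x) (T y) <= 1;
  adm_alpha_trans : forall x y z, 1 <= alpha x y -> 1 <= alpha y z -> 1 <= alpha x z;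
  adm_eta_trans : forall x y z, eta x y <= 1 -> eta y z <= 1 -> eta x z <= 1
}.

(* Functions (0,oo) -> (1,oo) and [1,oo) -> [1,oo) are represented by total
   functions on R, whose values outside the domain are never constrained. *)
Record in_Theta (theta : R -> R) : Prop := {
  Theta_range : forall t, 0 < t -> 1 < theta t;
  Theta_incr : forall t u, 0 < t -> t < u -> theta t < theta u;
  Theta_lim : forall t_ : nat -> R, (forall n, 0 < t_ n) ->
    (is_lim_seq (fun n => theta (t_ n)) 1 <-> is_lim_seq t_ 0);
  Theta_cont : continuous_on (fun t => 0 < t) theta
}.

Record in_Phi (phi : R -> R) : Prop := {
  Phi_range : forall t, 1 <= t -> 1 <= phi t;
  Phi_nondecr : forall t u, 1 <= t -> t <= u -> phi t <= phi u;
  Phi_iter : forall t, 1 < t -> is_lim_seq (fun n => Nat.iter n phi t) 1;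
  Phi_cont : continuous_on (fun t => 1 <= t) phi
}.

(* Since theta is total here, the positivity of its argument on the right-hand
   side has to be part of the contraction condition. *)
Definition theta_phi_contraction {X : Type} (s : R) (alpha eta d : X -> X -> R)
    (T : X -> X) : Prop :=
  exists (theta phi : R -> R) (b1 b2 b3 b4 : R),
    in_Theta theta /\ in_Phi phi /\
    0 <= b1 /\ 0 <= b2 /\ 0 <= b3 /\ 0 <= b4 /\
    b1 + b2 + b3 + b4 <= 1 /\ b3 < 1 / s /\
    forall x y, alpha_eta_rel alpha eta x y -> 0 < d (T x) (T y) ->
      let M := b1 * d x y + b2 * d (T x) x + b3 * d (T y) y + b4 * d y (T x) in
      0 < M /\ theta (s ^ 2 * d (T x) (T y)) <= phi (theta M).

(* Main.v *)
Require Import Defs.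
From Stdlib Require Import Reals.
From Coquelicot Require Import Coquelicot.
From Stdlib Require Import Lra Lia Classical.
Open Scope R_scope.

(** Since [phi t < t] for [t > 1] and [theta] is increasing, the contraction
    gives the linear inequality
    [s^2 d(Tx,Ty) < b1 d(x,y) + b2 d(Tx,x) + b3 d(Ty,y) + b4 d(y,Tx)] on related
    points. Along a Picard orbit without fixed point it makes [d(x_n,x_(n+1))]
    and [d(x_n,x_(n+2))] decay like [s^(-2n)], faster than the factor [s] that
    the rectangular inequality costs for every two steps, so the orbit is
    Cauchy. Its limit [z] is a fixed point because the rectangular inequality
    through [x_n, x_(n+1)] gives [d(z,Tz) <= (b3/s) d(z,Tz)] in the limit. *)

(** * Eliminating [theta] and [phi] *)

Lemma Phi_lt_id (phi : R -> R) (t : R) : in_Phi phi -> 1 < t -> phi t < t.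
Proof.
  intros hphi ht.
  destruct (Rlt_le_dec (phi t) t) as [h | h]; [exact h | exfalso].
  (* If [t <= phi t], monotonicity keeps all iterates above [t > 1], against their convergence to
     1. *)
  assert (hiter : forall n, t <= Nat.iter n phi t).
  { induction n as [|n IH]; simpl; [lra|].
    apply Rle_trans with (1 := h).
    apply (Phi_nondecr _ hphi); lra. }
  assert (hle : Rbar_le t 1).
  { exact (is_lim_seq_le (fun _ => t) _ t 1 hiter (is_lim_seq_const t)
             (Phi_iter _ hphi t ht)). }
  simpl in hle; lra.
Qed.

Lemma Theta_lt_reg (theta : R -> R) (t u : R) :
  in_Theta theta -> 0 < u -> theta t < theta u -> t < u.
Proof.
  intros htheta hu h.
  destruct (Rtotal_order t u) as [lt | [-> | gt]]; [exact lt | lra |].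
  pose proof (Theta_incr _ htheta u t hu gt); lra.
Qed.

Definition linear_contraction {X : Type} (s : R) (alpha eta d : X -> X -> R)
    (T : X -> X) (b1 b2 b3 b4 : R) : Prop :=
  forall x y, alpha_eta_rel alpha eta x y -> T x <> T y ->
    s ^ 2 * d (T x) (T y) <
    b1 * d x y + b2 * d (T x) x + b3 * d (T y) y + b4 * d y (T x).

(** * Rectangular b-metrics: the linear contraction and a Cauchy criterion *)

Section RectangularBMetric.

Context {X : Type} {s : R} {d : X -> X -> R} (hd : rect_bmetric s d).

Lemma rbm_refl (x : X) : d x x = 0.
Proof. now apply (rbm_sep _ _ hd). Qed.

Lemma rbm_pos (x y : X) : x <> y -> 0 < d x y.
Proof.
  intros hxy.
  destruct (rbm_nonneg _ _ hd x y) as [h | h]; [exact h|].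
  exfalso; apply hxy, (rbm_sep _ _ hd); auto.
Qed.

Lemma theta_phi_contraction_linear (alpha eta : X -> X -> R) (T : X -> X) :
  theta_phi_contraction s alpha eta d T ->
  exists b1 b2 b3 b4 : R,
    (0 <= b1 /\ 0 <= b2 /\ 0 <= b3 /\ 0 <= b4 /\ b1 + b2 + b3 + b4 <= 1) /\
    linear_contraction s alpha eta d T b1 b2 b3 b4.
Proof.
  intros (theta & phi & b1 & b2 & b3 & b4 & htheta & hphi
          & h1 & h2 & h3 & h4 & hsum & _ & hc).
  exists b1, b2, b3, b4; split; [tauto|].
  intros x y hr hT.
  destruct (hc x y hr (rbm_pos _ _ hT)) as [hM hle].
  apply (Theta_lt_reg theta _ _ htheta hM).
  apply Rle_lt_trans with (1 := hle).
  apply (Phi_lt_id _ _ hphi), (Theta_range _ htheta), hM.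
Qed.

(** Passing through [x_ (n+1)] and [x_ (n+2)] shortens the gap by two: it costs a factor [s] but
    gains [q ^ 2], and [s * q ^ 2 < 1] keeps the constant bounded. The rectangular inequality needs
    distinct intermediate points, so gaps one and two are separate base cases. *)
Lemma geometric_gap_bound (x_ : nat -> X) (C q : R) :
  (forall n m, (n < m)%nat -> x_ n <> x_ m) ->
  0 <= s -> 0 <= q -> s * q ^ 2 < 1 ->
  (forall n, d (x_ n) (x_ (S n)) <= C * q ^ n) ->
  (forall n, d (x_ n) (x_ (S (S n))) <= C * q ^ n) ->
  exists K, forall k n, d (x_ n) (x_ (n + k)%nat) <= K * q ^ n.
Proof.
  intros hinj hs hq hsq hD hE.
  assert (hC : 0 <= C).
  { pose proof (hD 0%nat) as h; simpl in h.
    pose proof (rbm_nonneg _ _ hd (x_ 0%nat) (x_ 1%nat)); lra. }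
  (* [K] is at least [C] and solves [K >= s C (1 + q) + s q^2 K]. *)
  set (K := (C + s * C * (1 + q)) / (1 - s * q ^ 2)).
  assert (hK : K * (1 - s * q ^ 2) = C + s * C * (1 + q)).
  { unfold K; field; lra. }
  assert (hp : 0 <= s * C * (1 + q)).
  { apply Rmult_le_pos; [now apply Rmult_le_pos | lra]. }
  assert (hsq0 : 0 <= s * q ^ 2).
  { apply Rmult_le_pos; [lra | apply pow2_ge_0]. }
  assert (hCK : C <= K).
  { assert (0 <= K).
    { apply Rmult_le_reg_r with (1 - s * q ^ 2); lra. }
    nra. }
  assert (hqn : forall n, 0 <= q ^ n) by (intros; now apply pow_le).
  exists K.
  (* The recursion descends by two, so two consecutive gaps are carried together. *)
  assert (hstep : forall k,
    (forall n, d (x_ n) (x_ (n + k)%nat) <= K * q ^ n) /\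
    (forall n, d (x_ n) (x_ (n + S k)%nat) <= K * q ^ n)).
  { induction k as [|k [IH0 IH1]].
    - split; intros n.
      + rewrite Nat.add_0_r, rbm_refl; apply Rmult_le_pos; [lra | apply hqn].
      + rewrite Nat.add_1_r; apply Rle_trans with (1 := hD n).
        now apply Rmult_le_compat_r.
    - split; [exact IH1|]; intros n.
      destruct k as [|k].
      + replace (n + 2)%nat with (S (S n)) by lia.
        apply Rle_trans with (1 := hE n).
        now apply Rmult_le_compat_r.
      + assert (hrect : d (x_ n) (x_ (n + S (S (S k)))%nat) <=
          s * (d (x_ n) (x_ (S n)) + d (x_ (S n)) (x_ (S (S n)))
               + d (x_ (S (S n))) (x_ (n + S (S (S k)))%nat))).
        { apply (rbm_rect _ _ hd);
            try (apply hinj; lia); apply not_eq_sym, hinj; lia. }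
        apply Rle_trans with (1 := hrect).
        pose proof (hD n) as h0. pose proof (hD (S n)) as h1.
        pose proof (IH0 (S (S n))) as h2.
        replace (S (S n) + S k)%nat with (n + S (S (S k)))%nat in h2 by lia.
        simpl pow in h1, h2.
        apply Rle_trans with (s * (C * q ^ n + C * (q * q ^ n) + K * (q * (q * q ^ n)))).
        { apply Rmult_le_compat_l; lra. }
        (* By [hK], [K - C] is exactly the coefficient of [q ^ n] in the bound just obtained;
           [C * q ^ n] is slack. *)
        replace (K * q ^ n) with (C * q ^ n + (K - C) * q ^ n) by ring.
        replace (K - C) with (s * C * (1 + q) + K * (s * q ^ 2)) by lra.
        pose proof (Rmult_le_pos _ _ hC (hqn n)).
        apply Rle_trans with ((s * C * (1 + q) + K * (s * q ^ 2)) * q ^ n);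
          [right; ring | lra]. }
  intros k; apply hstep.
Qed.

(** The bound is uniform in the gap [k], so a threshold on the smaller index controls all pairs. *)
Lemma geometric_cauchy (x_ : nat -> X) (K q : R) :
  0 <= q < 1 ->
  (forall k n, d (x_ n) (x_ (n + k)%nat) <= K * q ^ n) ->
  cauchy_seq d x_.
Proof.
  intros hq hK P [eps hP].
  assert (hlim : is_lim_seq (fun n => K * q ^ n) 0).
  { replace (Finite 0) with (Rbar_mult K 0) by (simpl; f_equal; ring).
    apply is_lim_seq_scal_l, is_lim_seq_geom.
    rewrite Rabs_pos_eq; lra. }
  apply is_lim_seq_spec in hlim.
  destruct (hlim eps) as [N hN].
  assert (hsmall : forall n m, (N <= n)%nat -> (n <= m)%nat -> d (x_ n) (x_ m) < eps).
  { intros n m hn hm.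
    pose proof (hK (m - n)%nat n) as h.
    replace (n + (m - n))%nat with m in h by lia.
    pose proof (hN n hn) as h'; rewrite Rminus_0_r in h'.
    apply Rabs_def2 in h'; lra. }
  apply (Filter_prod _ _ _ (fun n => (N <= n)%nat) (fun n => (N <= n)%nat));
    [exists N; auto | exists N; auto |].
  intros n m hn hm; apply hP; simpl.
  change (Rabs (d (x_ n) (x_ m) - 0) < eps).
  rewrite Rminus_0_r, Rabs_pos_eq by apply (rbm_nonneg _ _ hd).
  destruct (Nat.le_ge_cases n m).
  - now apply hsmall.
  - rewrite (rbm_sym _ _ hd); now apply hsmall.
Qed.

End RectangularBMetric.

(** An injective sequence meets [z] at most once. This supplies the distinctness conditions of the
    rectangular inequality near a limit. *)
Lemma injective_eventually_neq {X : Type} (x_ : nat -> X) (z : X) :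
  (forall n m, (n < m)%nat -> x_ n <> x_ m) -> eventually (fun n => x_ n <> z).
Proof.
  intros hinj.
  destruct (classic (exists n, x_ n = z)) as [[n hn] | hno].
  - exists (S n); intros m hm he.
    apply (hinj n m); [lia | congruence].
  - exists 0%nat; intros m _ he; apply hno; now exists m.
Qed.

Lemma orbit_rel {X : Type} (alpha eta : X -> X -> R) (T : X -> X) (x0 : X) :
  triangular_admissible alpha eta T ->
  alpha_eta_rel alpha eta x0 (T x0) ->
  forall n m, (n < m)%nat ->
    alpha_eta_rel alpha eta (Nat.iter n T x0) (Nat.iter m T x0).
Proof.
  (* The alternative that holds at [(x0, T x0)] propagates to the whole orbit. *)
  intros hadm [h0 | h0] n m hnm; [left | right].
  - assert (hstep : forall n, 1 <= alpha (Nat.iter n T x0) (Nat.iter (S n) T x0)).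
    { induction n0; [exact h0 | now apply (adm_alpha _ _ _ hadm)]. }
    induction hnm; [apply hstep|].
    now apply (adm_alpha_trans _ _ _ hadm) with (1 := IHhnm).
  - assert (hstep : forall n, eta (Nat.iter n T x0) (Nat.iter (S n) T x0) <= 1).
    { induction n0; [exact h0 | now apply (adm_eta _ _ _ hadm)]. }
    induction hnm; [apply hstep|].
    now apply (adm_eta_trans _ _ _ hadm) with (1 := IHhnm).
Qed.

(** * Fixed points of a linear contraction *)

Section LinearContraction.

Context {X : Type} {s : R} {d alpha eta : X -> X -> R} {T : X -> X}
  {b1 b2 b3 b4 : R}.
Hypotheses (hs : 1 < s) (hd : rect_bmetric s d)
  (hb : 0 <= b1 /\ 0 <= b2 /\ 0 <= b3 /\ 0 <= b4 /\ b1 + b2 + b3 + b4 <= 1)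
  (hlin : linear_contraction s alpha eta d T b1 b2 b3 b4).

Let s_sqr_gt1 : 1 < s ^ 2.
Proof. nra. Qed.

Let le_s_sqr_mul (a : R) : 0 <= a -> a <= s ^ 2 * a.
Proof. nra. Qed.

(** At fixed points the [b2] and [b3] terms vanish, leaving [s^2 D < (b1 + b4) D <= D] with
    [D = d z u > 0]. *)
Lemma linear_contraction_fixed_unique (z u : X) :
  Fix T z -> Fix T u -> alpha_eta_rel alpha eta z u -> z = u.
Proof.
  unfold Fix; intros hz hu hr.
  destruct (classic (z = u)) as [h | h]; [exact h | exfalso].
  pose proof (hlin z u hr ltac:(congruence)) as hc.
  rewrite hz, hu, !(rbm_refl hd), (rbm_sym _ _ hd u z) in hc.
  pose proof (rbm_pos hd z u h); nra.
Qed.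

(** * Picard orbits without a fixed point *)

Section Orbit.

Context {x_ : nat -> X}.
Hypotheses (hstep : forall n, x_ (S n) = T (x_ n))
  (hrel : forall n m, (n < m)%nat -> alpha_eta_rel alpha eta (x_ n) (x_ m))
  (hne : forall n, x_ (S n) <> x_ n).

Lemma orbit_contraction (n m : nat) : (n < m)%nat -> x_ (S n) <> x_ (S m) ->
  s ^ 2 * d (x_ (S n)) (x_ (S m)) <
  b1 * d (x_ n) (x_ m) + b2 * d (x_ n) (x_ (S n))
  + b3 * d (x_ m) (x_ (S m)) + b4 * d (x_ m) (x_ (S n)).
Proof.
  intros hnm hT.
  rewrite (rbm_sym _ _ hd (x_ n) (x_ (S n))), (rbm_sym _ _ hd (x_ m) (x_ (S m))).
  rewrite !hstep in hT |- *.
  now apply hlin; [apply hrel|].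
Qed.

(** For consecutive points the [b4] term is zero. A new step longer than the old one would satisfy
    [s^2 a < a]; hence the right-hand side is at most the old step. *)
Lemma orbit_step_decay (n : nat) :
  s ^ 2 * d (x_ (S n)) (x_ (S (S n))) <= d (x_ n) (x_ (S n)).
Proof.
  pose proof (orbit_contraction n (S n) ltac:(lia) (not_eq_sym (hne (S n)))) as h.
  rewrite (rbm_refl hd) in h.
  pose proof (rbm_nonneg _ _ hd (x_ n) (x_ (S n))).
  pose proof (rbm_nonneg _ _ hd (x_ (S n)) (x_ (S (S n)))).
  destruct (Rle_lt_dec (d (x_ (S n)) (x_ (S (S n)))) (d (x_ n) (x_ (S n)))); nra.
Qed.

(** Step lengths strictly decrease, whereas a repeated point would repeat its step length. *)
Lemma orbit_injective (n m : nat) : (n < m)%nat -> x_ n <> x_ m.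
Proof.
  intros hnm he.
  assert (hlt : forall k, d (x_ (S k)) (x_ (S (S k))) < d (x_ k) (x_ (S k))).
  { intros k; pose proof (orbit_step_decay k).
    pose proof (rbm_pos hd _ _ (not_eq_sym (hne (S k)))); nra. }
  assert (hnm' : d (x_ m) (x_ (S m)) < d (x_ n) (x_ (S n))).
  { clear he; induction hnm as [|m _ IH]; [apply hlt|].
    now apply Rlt_trans with (2 := IH). }
  rewrite !hstep, he in hnm'; lra.
Qed.

Lemma orbit_geometric : exists C,
  (forall n, d (x_ n) (x_ (S n)) <= C * (/ s ^ 2) ^ n) /\
  (forall n, d (x_ n) (x_ (S (S n))) <= C * (/ s ^ 2) ^ n).
Proof.
  set (C := Rmax (d (x_ 0%nat) (x_ 1%nat)) (d (x_ 0%nat) (x_ 2%nat))).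
  exists C.
  assert (hdiv : forall a c n, s ^ 2 * a <= c * (/ s ^ 2) ^ n ->
                   a <= c * (/ s ^ 2) ^ S n).
  { intros a c n h.
    apply Rmult_le_reg_l with (s ^ 2); [lra|].
    apply Rle_trans with (1 := h); right.
    rewrite <- (tech_pow_Rmult (/ s ^ 2)).
    generalize ((/ s ^ 2) ^ n); intros p; field; lra. }
  assert (hboth : forall n, d (x_ n) (x_ (S n)) <= C * (/ s ^ 2) ^ n /\
                            d (x_ n) (x_ (S (S n))) <= C * (/ s ^ 2) ^ n).
  { induction n as [|n [IHD IHE]].
    - simpl; rewrite Rmult_1_r; split; [apply Rmax_l | apply Rmax_r].
    - pose proof (orbit_step_decay n) as hD.
      split; apply hdiv; [lra|].
      pose proof (orbit_step_decay (S n)) as hD'.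
      pose proof (orbit_contraction n (S (S n)) ltac:(lia)
                    (orbit_injective (S n) (S (S (S n))) ltac:(lia))) as hE.
      rewrite (rbm_sym _ _ hd (x_ (S (S n))) (x_ (S n))) in hE.
      pose proof (rbm_nonneg _ _ hd (x_ (S n)) (x_ (S (S n)))) as h1.
      pose proof (rbm_nonneg _ _ hd (x_ (S (S n))) (x_ (S (S (S n))))) as h2.
      (* [B] bounds all four distances on the right of [hE], whose weights sum to at most 1. *)
      set (B := C * (/ s ^ 2) ^ n) in *.
      assert (hD1 : d (x_ (S n)) (x_ (S (S n))) <= B)
        by (apply Rle_trans with (1 := le_s_sqr_mul _ h1); lra).
      assert (hD2 : d (x_ (S (S n))) (x_ (S (S (S n)))) <= B)
        by (apply Rle_trans with (1 := le_s_sqr_mul _ h2); lra).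
      assert (hB : 0 <= B) by lra.
      destruct hb as (p1 & p2 & p3 & p4 & hsum).
      pose proof (Rmult_le_compat_l _ _ _ p1 IHE).
      pose proof (Rmult_le_compat_l _ _ _ p2 IHD).
      pose proof (Rmult_le_compat_l _ _ _ p3 hD2).
      pose proof (Rmult_le_compat_l _ _ _ p4 hD1).
      pose proof (Rmult_le_compat_r _ _ _ hB hsum); lra. }
  split; intros n; apply hboth.
Qed.

Lemma orbit_cauchy : cauchy_seq d x_.
Proof.
  assert (hq : 0 < / s ^ 2 < 1).
  { split; [apply Rinv_0_lt_compat; lra|].
    rewrite <- Rinv_1; apply Rinv_lt_contravar; lra. }
  (* For the ratio [q = s^(-2)], the product [s q^2] is [s^(-3)]. *)
  assert (hsq : s * (/ s ^ 2) ^ 2 < 1).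
  { apply Rmult_lt_reg_l with (s ^ 3); [apply pow_lt; lra|].
    replace (s ^ 3 * (s * (/ s ^ 2) ^ 2)) with 1 by (field; lra).
    nra. }
  destruct orbit_geometric as [C [hD hE]].
  destruct (geometric_gap_bound hd x_ C (/ s ^ 2)) as [K hK];
    try assumption; try lra; [exact orbit_injective|].
  apply (geometric_cauchy hd x_ K (/ s ^ 2)); [lra | exact hK].
Qed.

(** Since [d] need not be continuous, [d (x_ (S n)) (T z)] is estimated through the contraction, at
    a single late index. *)
Lemma orbit_limit_fixed (z : X) :
  converges d x_ z -> (forall n, alpha_eta_rel alpha eta (x_ n) z) -> Fix T z.
Proof.
  intros hz hrz.
  destruct (classic (T z = z)) as [h | hTz]; [exact h | exfalso].
  pose proof (rbm_pos hd z (T z) (not_eq_sym hTz)) as hpos.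
  destruct orbit_geometric as [C [hD _]].
  assert (hDlim : is_lim_seq (fun n => d (x_ n) (x_ (S n))) 0).
  { apply is_lim_seq_le_le with (u := fun _ => 0) (w := fun n => C * (/ s ^ 2) ^ n).
    - intros n; split; [apply (rbm_nonneg _ _ hd) | apply hD].
    - apply is_lim_seq_const.
    - replace (Finite 0) with (Rbar_mult C 0) by (simpl; f_equal; ring).
      apply is_lim_seq_scal_l, is_lim_seq_geom.
      rewrite Rabs_pos_eq by (left; apply Rinv_0_lt_compat; lra).
      rewrite <- Rinv_1; apply Rinv_lt_contravar; lra. }
  pose proof (proj1 (is_lim_seq_incr_1 _ _) hz) as hz1.
  apply is_lim_seq_spec in hz; apply is_lim_seq_spec in hz1;
    apply is_lim_seq_spec in hDlim.
  (* The tolerance makes [4 s^2 eps] equal to the difference between [s D] and [D], where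
     [D = d z (T z)]. *)
  assert (heps : 0 < (s - 1) * d z (T z) / (4 * s ^ 2)).
  { apply Rdiv_lt_0_compat; [apply Rmult_lt_0_compat|]; lra. }
  set (eps := mkposreal _ heps).
  (* The inequations serve the rectangular inequality between [z] and [T z]; the last one also
     triggers the contraction at [(x_ n, z)]. *)
  assert (hev : eventually (fun n =>
    (d (x_ n) z < eps /\ d (x_ (S n)) z < eps /\ d (x_ n) (x_ (S n)) < eps) /\
    ((x_ n <> z /\ x_ n <> T z) /\ (x_ (S n) <> z /\ x_ (S n) <> T z)))).
  { assert (hd0 : forall a, Rabs (a - 0) < eps -> a < eps).
    { intros a ha; apply Rabs_def2 in ha; lra. }
    assert (hshift : forall P, eventually P -> eventually (fun n => P (S n))).
    { intros P [N hN]; exists N; intros n hn; apply hN; lia. }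
    repeat apply filter_and.
    - generalize (hz eps); apply filter_imp; auto.
    - generalize (hz1 eps); apply filter_imp; auto.
    - generalize (hDlim eps); apply filter_imp; auto.
    - apply injective_eventually_neq, orbit_injective.
    - apply injective_eventually_neq, orbit_injective.
    - apply (hshift (fun n => x_ n <> z)), injective_eventually_neq, orbit_injective.
    - apply (hshift (fun n => x_ n <> T z)), injective_eventually_neq, orbit_injective. }
  destruct hev as [N hN].
  destruct (hN N (Nat.le_refl N)) as [[e1 [e2 e3]] [[n1 n2] [n3 n4]]].
  assert (hrect : d z (T z) <=
    s * (d z (x_ N) + d (x_ N) (x_ (S N)) + d (x_ (S N)) (T z))).
  { apply (rbm_rect _ _ hd); auto. }
  pose proof (hlin (x_ N) z (hrz N)) as hc.
  rewrite <- hstep in hc; specialize (hc n4).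
  rewrite (rbm_sym _ _ hd (x_ (S N)) (x_ N)), (rbm_sym _ _ hd (T z) z),
    (rbm_sym _ _ hd z (x_ (S N))) in hc.
  rewrite (rbm_sym _ _ hd z (x_ N)) in hrect.
  pose proof (rbm_nonneg _ _ hd (x_ N) z).
  pose proof (rbm_nonneg _ _ hd (x_ (S N)) z).
  pose proof (rbm_nonneg _ _ hd (x_ N) (x_ (S N))).
  assert (he : eps * (4 * s ^ 2) = (s - 1) * d z (T z)).
  { unfold eps; simpl; field; lra. }
  pose proof (cond_pos eps) as hp.
  set (e := pos eps) in *.
  (* The three small distances have total weight [b1 + b2 + b4 <= 1], and [b3 <= 1]. *)
  assert (hc' : s ^ 2 * d (x_ (S N)) (T z) < e + d z (T z)) by nra.
  (* Multiplying the rectangular inequality by [s]: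
     [s D <= 2 s^2 e + e + D < 4 s^2 e + D = s D], where [D = d z (T z)]. *)
  assert (s * d z (T z) <= s ^ 2 * (e + e) + s ^ 2 * d (x_ (S N)) (T z)) by nra.
  nra.
Qed.

End Orbit.

End LinearContraction.

Theorem theorem3p5 (X : Type) (s : R) (d alpha eta : X -> X -> R) (T : X -> X)
  (hs : 1 < s)
  (hd : rect_bmetric s d)
  (halpha : forall x y, 0 <= alpha x y)
  (heta : forall x y, 0 <= eta x y)
  (hcomplete : alpha_eta_complete alpha eta d)
  (hadm : triangular_admissible alpha eta T)
  (hcontr : theta_phi_contraction s alpha eta d T)
  (hx0 : exists x0, alpha_eta_rel alpha eta x0 (T x0))
  (hreg : alpha_eta_regular alpha eta d) :
  (exists z, Fix T z) /\
  ((forall z u, Fix T z -> Fix T u -> alpha_eta_rel alpha eta z u) ->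
   exists! z, Fix T z).
Proof.
  destruct (theta_phi_contraction_linear hd alpha eta T hcontr)
    as (b1 & b2 & b3 & b4 & hb & hlin).
  assert (hex : exists z, Fix T z).
  { destruct hx0 as [x0 h0].
    set (x_ := fun n => Nat.iter n T x0).
    assert (hrel : forall n m, (n < m)%nat -> alpha_eta_rel alpha eta (x_ n) (x_ m))
      by exact (orbit_rel alpha eta T x0 hadm h0).
    assert (hsucc : forall n, x_ (S n) = T (x_ n)) by reflexivity.
    (* A stationary index already gives a fixed point; otherwise the orbit estimates apply. *)
    destruct (classic (exists n, x_ (S n) = x_ n)) as [[n hn] | hno].
    { now exists (x_ n). }
    assert (hne : forall n, x_ (S n) <> x_ n).
    { intros n hn; apply hno; now exists n. }
    assert (hrel1 : forall n, alpha_eta_rel alpha eta (x_ n) (x_ (S n))).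
    { intros n; apply hrel; lia. }
    destruct (hcomplete x_ (orbit_cauchy hs hd hb hlin hsucc hrel hne) hrel1)
      as [z hz].
    exists z.
    exact (orbit_limit_fixed hs hd hb hlin hsucc hrel hne z hz (hreg x_ z hz hrel1)). }
  split; [exact hex|].
  intros hfix; destruct hex as [z hz].
  exists z; split; [exact hz|].
  intros u hu.
  exact (linear_contraction_fixed_unique hs hd hb hlin z u hz hu (hfix z u hz hu)).
Qed.
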